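(* Let $(X,\mathcal{B},\mu)$ be a probability space, let $k\geq 1$ and let $M_1,\dots,M_k$ be PSD doubly-stochastic operators on $L^2(\mu)$. Then for every bounded non-negative measurable function $f$ on $X$ we have $$\int_X f \prod_{i=1}^k M_i f\,d\mu \ \geq\ \left(\int_X f\,d\mu\right)^{k+1}.$$
   Context: A linear operator $M$ on $L^2(\mu)$ is called doubly-stochastic if (1) $Mf\geq 0$ whenever $f\geq 0$; (2) $M\mathbf{1}_X=\mathbf{1}_X$; (3) $\int_X Mf\,d\mu=\int_X f\,d\mu$ for all $f$. It is a PSD doubly-stochastic operator if in addition it is self-adjoint and (4) $\langle Mf,f\rangle\geq 0$ for all $f\in L^2(\mu)$. (In)equalities between functions are understood $\mu$-almost everywhere. *)

(* Defs.v *)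
From HB Require Import structures.
From mathcomp Require Import all_boot all_order all_algebra.
From mathcomp Require Import all_classical all_reals all_analysis.
From mathcomp Require Import measurable_realfun ess_sup_inf.

Set Implicit Arguments.
Unset Strict Implicit.
Unset Printing Implicit Defensive.

Import Order.TTheory GRing.Theory Num.Def Num.Theory.
Import numFieldNormedType.Exports.

Local Open Scope classical_set_scope.
Local Open Scope ring_scope.

Lemma Lnorm_ae_eq (d : measure_display) (T : measurableType d) (R : realType)
    (mu : {measure set T -> \bar R}) (p : \bar R) (f g : T -> R) :
  measurable_fun setT f -> measurable_fun setT g -> f = g %[ae mu] ->
  ('N[mu]_p[EFin \o f] = 'N[mu]_p[EFin \o g])%E.
Proof.
move=> mf mg fg; rewrite unlock /Lnorm; case: p => [r||].
- have mpow (h : T -> R) : measurable_fun setT h ->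
      measurable_fun setT (fun x => (`|(EFin \o h) x| `^ r)%E).
    move=> mh; apply: (measurableT_comp (measurable_poweR r)).
    by apply: measurableT_comp => //; exact/measurable_EFinP.
  congr (_ `^ _)%E; apply: ae_eq_integral => //; [exact: mpow|exact: mpow|].
  by apply: filterS fg => x + _ => /(_ I) /= ->.
- case: ifPn => // _; apply: eq_ess_sup.
  by apply: filterS fg => x /(_ I) /= ->.
- case: ifPn => // _; apply: eq_ess_inf.
  by apply: filterS fg => x /(_ I) /= ->.
Qed.

(* [LspaceType mu p1], the functions of [LfunType mu p1] modulo equality
   mu-a.e., comes without a vector space structure: we transport that of
   [LfunType mu p1]. *)
Section Lspace_lmodType.
Context (d : measure_display) (T : measurableType d) (R : realType).
Variables (mu : {measure set T -> \bar R}) (p : \bar R) (p1 : (1 <= p)%E).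
Local Open Scope quotient_scope.

Local Notation Lf := (LfunType mu p1).
Local Notation Lp := (LspaceType mu p1).
Local Notation mf := {mfun T >-> measurableTypeR R}.
Local Notation Q := {mfun_ mu, T >-> measurableTypeR R}.

Lemma measurable_mfun_mu (F : Q) : measurable_fun setT (F : T -> R).
Proof. exact: (@measurable_funPT _ _ _ _ (repr F)). Qed.

(* [LfunType] and [{mfun_ mu, _ >-> _}] use two copies of the Borel sigma-algebra
   of [R] that only differ by their displays, hence the repackaging. *)
Lemma measurable_Lfun (f : Lf) :
  @measurable_fun _ _ T (measurableTypeR R) setT f.
Proof. exact: (@measurable_funPT _ _ _ _ f). Qed.

Definition mfun_of_Lfun (f : Lf) : mf :=
  MeasurableFun.Pack (MeasurableFun.Class
    (@isMeasurableFun.Build _ _ T (measurableTypeR R) f (measurable_Lfun f))).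

Definition mclass (f : Lf) : Q := \pi_Q (mfun_of_Lfun f).

Lemma mclass_ae (f : Lf) : (mclass f : T -> R) = f %[ae mu].
Proof.
have /eqP := reprK (mclass f).
by rewrite {2}/mclass eqmodE => /asboolP H; exact: H.
Qed.

Lemma finite_norm_mclass (f : Lf) : finite_norm mu p (mclass f : T -> R).
Proof.
have mf : measurable_fun setT (f : T -> R) by exact: measurable_funPT.
rewrite /finite_norm (Lnorm_ae_eq p (measurable_mfun_mu _) mf (mclass_ae f)).
exact: Lfunction_finite.
Qed.

Definition Lclass (f : Lf) : Lp :=
  LebesgueSpace.Pack (LebesgueSpace.Class
    (isFinLebesgue.Build d T R mu p p1 (mclass f) (finite_norm_mclass f))).

Lemma Lspace_Lfun (F : Lp) : (F : T -> R) \in Lfun mu p.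
Proof.
rewrite inE; apply/andP; split; rewrite inE /=.
  exact: measurable_mfun_mu.
exact: Lebesgue_finite.
Qed.

Definition Lrep (F : Lp) : Lf := Lfun_Sub p1 (Lspace_Lfun F).

Lemma Lclass_ae (f : Lf) : (Lclass f : T -> R) = f %[ae mu].
Proof. exact: mclass_ae. Qed.

Lemma Lspace_eqP (F G : Lp) : F = G <-> (F : T -> R) = G %[ae mu].
Proof.
split=> [->|FG]; first exact: ae_eq_refl.
have : (F : Q) = (G : Q).
  by rewrite -[LHS]reprK -[RHS]reprK; apply/eqP; rewrite eqmodE; apply/asboolP.
case: F G {FG} => [F [[HF]]] [G [[HG]]] /= FG.
by case: _ / FG HG => HG; rewrite (bool_irrelevance HF HG).
Qed.

Lemma Lrep_ae (F : Lp) : (Lrep F : T -> R) = F %[ae mu].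
Proof. exact: ae_eq_refl. Qed.

Lemma LrepK : cancel Lrep Lclass.
Proof. by move=> F; apply/Lspace_eqP; exact: Lclass_ae. Qed.

Lemma Lclass_eqP (f g : Lf) : Lclass f = Lclass g <-> (f : T -> R) = g %[ae mu].
Proof.
rewrite Lspace_eqP; split=> fg.
  exact: (ae_eq_trans (ae_eq_sym (Lclass_ae f)) (ae_eq_trans fg (Lclass_ae g))).
exact: (ae_eq_trans (Lclass_ae f) (ae_eq_trans fg (ae_eq_sym (Lclass_ae g)))).
Qed.

Definition Lspace_zero : Lp := Lclass 0.
Definition Lspace_opp (F : Lp) : Lp := Lclass (- Lrep F).
Definition Lspace_add (F G : Lp) : Lp := Lclass (Lrep F + Lrep G).
Definition Lspace_scale (a : R) (F : Lp) : Lp := Lclass (a *: Lrep F).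

Lemma Lclass_opp (f : Lf) : Lspace_opp (Lclass f) = Lclass (- f).
Proof.
apply/Lclass_eqP; apply: filterS (Lclass_ae f) => x /(_ I) /= fx _.
by rewrite /= /Lrep /= !fctE /= fx.
Qed.

Lemma Lclass_add (f g : Lf) : Lspace_add (Lclass f) (Lclass g) = Lclass (f + g).
Proof.
apply/Lclass_eqP.
apply: filterS2 (Lclass_ae f) (Lclass_ae g) => x /(_ I) /= fx /(_ I) /= gx _.
by rewrite /= !fctE /= fx gx.
Qed.

Lemma Lclass_scale (a : R) (f : Lf) :
  Lspace_scale a (Lclass f) = Lclass (a *: f).
Proof.
apply/Lclass_eqP; apply: filterS (Lclass_ae f) => x /(_ I) /= fx _.
by rewrite /= !fctE /= fx.
Qed.

Lemma Lspace_addA : associative Lspace_add.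
Proof.
move=> F G H; rewrite -(LrepK F) -(LrepK G) -(LrepK H).
by rewrite !Lclass_add addrA.
Qed.

Lemma Lspace_addC : commutative Lspace_add.
Proof. by move=> F G; rewrite -(LrepK F) -(LrepK G) !Lclass_add addrC. Qed.

Lemma Lspace_add0 : left_id Lspace_zero Lspace_add.
Proof. by move=> F; rewrite -(LrepK F) Lclass_add add0r. Qed.

Lemma Lspace_addN : left_inverse Lspace_zero Lspace_opp Lspace_add.
Proof. by move=> F; rewrite -(LrepK F) Lclass_opp Lclass_add addNr. Qed.

HB.instance Definition _ := gen_eqMixin Lp.
HB.instance Definition _ := gen_choiceMixin Lp.
HB.instance Definition _ := GRing.isZmodule.Build Lp
  Lspace_addA Lspace_addC Lspace_add0 Lspace_addN.

Lemma Lspace_scaleA (a b : R) (F : Lp) :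
  Lspace_scale a (Lspace_scale b F) = Lspace_scale (a * b) F.
Proof. by rewrite -(LrepK F) !Lclass_scale scalerA. Qed.

Lemma Lspace_scale1 : left_id 1 Lspace_scale.
Proof. by move=> F; rewrite -(LrepK F) Lclass_scale scale1r. Qed.

Lemma Lspace_scaleDr : right_distributive Lspace_scale +%R.
Proof.
move=> a F G; rewrite /GRing.add /= -(LrepK F) -(LrepK G).
by rewrite !(Lclass_add, Lclass_scale) scalerDr.
Qed.

Lemma Lspace_scaleDl (F : Lp) :
  {morph Lspace_scale^~ F : a b / a + b >-> a + b}.
Proof.
move=> a b; rewrite [RHS]/GRing.add /= -(LrepK F).
by rewrite !(Lclass_add, Lclass_scale) scalerDl.
Qed.

HB.instance Definition _ := GRing.Zmodule_isLmodule.Build R Lp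
  Lspace_scaleA Lspace_scale1 Lspace_scaleDr Lspace_scaleDl.

Lemma Lclass_is_linear : linear Lclass.
Proof. by move=> a f g; rewrite -Lclass_add -Lclass_scale. Qed.

HB.instance Definition _ :=
  GRing.isLinear.Build R Lf Lp _ Lclass Lclass_is_linear.

Lemma LspaceDE (F G : Lp) :
  ((F + G : Lp) : T -> R) = (fun x => F x + G x) %[ae mu].
Proof. exact: Lclass_ae. Qed.

Lemma LspaceZE (a : R) (F : Lp) :
  ((a *: F : Lp) : T -> R) = (fun x => a * F x) %[ae mu].
Proof. exact: Lclass_ae. Qed.

End Lspace_lmodType.

Section doubly_stochastic.
Context (d : measure_display) (T : measurableType d) (R : realType).
Variable mu : probability T R.
Local Notation L2 := (LspaceType2 mu).

Lemma bounded_Lfun2 (f : T -> R) :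
  measurable_fun setT f -> bounded_fun f -> f \in Lfun mu 2%:E.
Proof.
move=> mf [M [Mreal fM]].
have fC x : `|f x| <= `|M| + 1.
  by apply: fM => //; rewrite (le_lt_trans (ler_norm M)) // ltrDl.
apply: (@Lfun_subset _ _ _ mu 2%:E +oo%E) => //.
- by rewrite lee1n.
- by rewrite leey.
- exact: fin_num_measure.
- by rewrite leey.
rewrite inE; apply/andP; split; rewrite inE //= /finite_norm unlock /Lnorm.
case: ifPn => // _; apply: (@le_lt_trans _ _ (`|M| + 1)%:E); last exact: ltry.
by apply/ess_supP/nearW => x /=; rewrite lee_fin.
Qed.

Definition bounded_L2 (f : T -> R) (mf : measurable_fun setT f)
    (bf : bounded_fun f) : L2 :=
  Lclass (Lfun_Sub (lee1n 2) (bounded_Lfun2 mf bf)).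

Lemma bounded_L2_ae (f : T -> R) (mf : measurable_fun setT f)
    (bf : bounded_fun f) : (bounded_L2 mf bf : T -> R) = f %[ae mu].
Proof. exact: Lclass_ae. Qed.

Definition cst1_L2 : L2 := Lclass (Lfun_Sub (lee1n 2) (Lfun_cst mu 1 2)).

Definition L2dot (F G : L2) : \bar R := (\int[mu]_x (F x * G x)%:E)%E.

Record doubly_stochastic (M : {linear L2 -> L2}) : Prop := {
  ds_ge0 : forall F : L2, (\forall x \ae mu, 0 <= F x) ->
    \forall x \ae mu, 0 <= M F x ;
  ds_cst1 : M cst1_L2 = cst1_L2 ;
  ds_integral : forall F : L2,
    (\int[mu]_x (M F x)%:E = \int[mu]_x (F x)%:E)%E }.

Record PSD_doubly_stochastic (M : {linear L2 -> L2}) : Prop := {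
  psd_ds : doubly_stochastic M ;
  psd_selfadjoint : forall F G : L2, L2dot (M F) G = L2dot F (M G) ;
  psd_ge0 : forall F : L2, (0 <= L2dot (M F) F)%E }.

End doubly_stochastic.

Arguments bounded_L2 {d T R} mu {f} mf bf.

(* Main.v *)
(** Write [c] for the integral of [f].  Evaluating
    [prod y_i >= 1 + sum ln y_i >= 1 + sum (1 - 1 / y_i)] at [y_i = M_i f / c]
    and integrating against [f] reduces the inequality to
    [\int f / M f <= 1] for each PSD doubly-stochastic [M].  Let [u = 1 / M f].
    Cauchy-Schwarz for the form [<M h, h>] gives
    [(\int f u)^2 <= <M (f u), f u>], positivity of [M] gives
    [<M (f u), f u> <= <M f, f u^2>], and the right-hand side is [\int f u].
    To avoid dividing by [0], [M f] is replaced by [M f + e], and [e] tends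
    to [0] at the end. *)
Require Import Defs.
From mathcomp Require Import all_boot all_order all_algebra.
From mathcomp Require Import all_classical all_reals all_analysis.
From mathcomp Require Import measurable_realfun.
From mathcomp Require Import ess_sup_inf ring lra.

Local Open Scope classical_set_scope.
Local Open Scope ring_scope.
Import Order.TTheory GRing.Theory Num.Def Num.Theory.
Import numFieldNormedType.Exports.

(** * Elementary inequalities for real numbers *)

Section real_inequalities.
Context {R : realType}.

(** This is AM-GM for the [k.+1] numbers [\prod_i y i] and [(y i)^-1], whose product is 1. It
    follows from [ln z <= z - 1], used once at the product and once at each inverse. *)
Lemma prod_add_sum_inv_ge (k : nat) (y : 'I_k -> R) :
  (forall i, 0 < y i) -> k.+1%:R <= \prod_i y i + \sum_i (y i)^-1.
Proof.
move=> y0; have ln_sub (z : R) : 0 < z -> 1 - z^-1 <= ln z.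
  move=> z0; have zV : 0 < z^-1 by rewrite invr_gt0.
  have : ln (1 + (z^-1 - 1)) <= z^-1 - 1 by apply: le_ln1Dx; lra.
  rewrite [1 + _]addrC subrK lnV ?posrE//; lra.
have [p0 lnp] : 0 < \prod_i y i /\ \sum_i ln (y i) = ln (\prod_i y i).
  elim/big_rec2: _ => [|i p s _ [p0 ->]]; first by rewrite ln1.
  by rewrite mulr_gt0// lnM ?posrE.
have : \sum_i (1 - (y i)^-1) <= \sum_i ln (y i).
  by apply: ler_sum => i _; exact: ln_sub.
rewrite lnp sumrB sumr_const card_ord -natr1 => H.
have : ln (1 + (\prod_i y i - 1)) <= \prod_i y i - 1 by apply: le_ln1Dx; lra.
rewrite [1 + _]addrC subrK; lra.
Qed.

(** Makes the cost of the shift by [e] linear in [e] and uniform in [a], so that the shift can be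
    removed under the integral. The constant is crude: after expansion, each of the [k] error terms
    is at most [e * (B + 1) ^+ k]. *)
Lemma prod_addr_le (k : nat) (a : 'I_k -> R) (B e : R) :
  (forall i, 0 <= a i <= B) -> 0 <= e <= 1 ->
  \prod_i (a i + e) <= \prod_i a i + e * (k%:R * (B + 1) ^+ k).
Proof.
elim: k a => [|k IH] a aB e01; first by rewrite !big_ord0 !mul0r mulr0 addr0.
rewrite !big_ord_recl.
have := IH (a \o lift ord0) (fun i => aB _) e01.
set P := \prod_(i < k) (_ + e); set Q := \prod_(i < k) _ => PQ.
have Q0 : 0 <= Q by apply: prodr_ge0 => i _; have /andP[] := aB (lift ord0 i).
have /andP[a0 aB0] := aB ord0.
have QB : Q <= (B + 1) ^+ k.
  rewrite -[k in leRHS]card_ord -prodr_const; apply: ler_prod => i _.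
  by have /andP[? ?] := aB (lift ord0 i); apply/andP; split => //=; lra.
rewrite exprS -natr1.
set X := (B + 1) ^+ k in PQ QB *.
have ae : 0 <= a ord0 + e <= B + 1 by lra.
have X0 : 0 <= X by lra.
have kX : 0 <= k%:R * X by rewrite mulr_ge0.
have H1 : (a ord0 + e) * P <= (a ord0 + e) * (Q + e * (k%:R * X)).
  by apply: ler_wpM2l => //; lra.
apply: (le_trans H1).
have H2 : (a ord0 + e) * (e * (k%:R * X)) <= (B + 1) * (e * (k%:R * X)).
  by apply: ler_wpM2r; [apply: mulr_ge0 => //; lra | lra].
(* Since [0 <= a ord0 <= B], one has [B + 1 >= 1]; this term accounts for the passage from [k] to
   [k.+1] in the constant. *)
have H3 : e * Q <= e * ((B + 1) * X).
  apply: ler_wpM2l; first lra.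
  apply: (le_trans QB); rewrite -[leLHS]mul1r ler_wpM2r//; lra.
nra.
Qed.

(** The set where a continuous function is negative is open, so it contains a rational as soon as it
    is nonempty. *)
Lemma quadratic_ge0_rat (a b c : R) :
  (forall q : rat, 0 <= a - ratr q * b + ratr q ^+ 2 * c) ->
  forall t : R, 0 <= a - t * b + t ^+ 2 * c.
Proof.
move=> H t; rewrite leNgt; apply/negP => H0.
have cp : continuous (fun t : R => a - t * b + t ^+ 2 * c).
  move=> s; apply: cvgD; first apply: cvgB; first exact: cvg_cst.
  - by apply: cvgM; [exact: cvg_id|exact: cvg_cst].
  - by apply: cvgM; [exact: exprn_continuous|exact: cvg_cst].
have oU := open_comp (fun x _ => cp x) (@open_lt R 0).
have := @dense_rat R _ _ oU; case; first by exists t.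
by move=> s [/= s0 [q _ qs]]; have := H q; rewrite qs leNgt s0.
Qed.

End real_inequalities.

(** * Essentially bounded functions and their integrals *)

Section ae_bounded.
Context {d : measure_display} {T : measurableType d} {R : realType}.
Variable mu : probability T R.

(** A working class inside every L^p, closed under sums and products and, by [DS_ae_bounded], under
    doubly-stochastic operators. All the integrals below are therefore finite real numbers. The
    bound holds only a.e. because [M f] is determined only up to null sets. *)
Definition ae_bounded (f : T -> R) :=
  measurable_fun setT f /\ exists C, \forall x \ae mu, `|f x| <= C.

Lemma ae_bounded_cst (c : R) : ae_bounded (fun=> c).
Proof. by split; [exact: measurable_cst|exists `|c|; exact: nearW]. Qed.

Lemma ae_boundedD (f g : T -> R) :
  ae_bounded f -> ae_bounded g -> ae_bounded (fun x => f x + g x).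
Proof.
move=> [mf [C fC]] [mg [D gD]]; split; first exact: measurable_funD.
exists (C + D); apply: filterS2 fC gD => x fx gx.
by rewrite (le_trans (ler_normD _ _))// lerD.
Qed.

Lemma ae_boundedM (f g : T -> R) :
  ae_bounded f -> ae_bounded g -> ae_bounded (fun x => f x * g x).
Proof.
move=> [mf [C fC]] [mg [D gD]]; split; first exact: measurable_funM.
exists (C * D); apply: filterS2 fC gD => x fx gx.
by rewrite normrM ler_pM.
Qed.

Lemma ae_boundedB (f g : T -> R) :
  ae_bounded f -> ae_bounded g -> ae_bounded (fun x => f x - g x).
Proof.
move=> [mf [C fC]] [mg [D gD]]; split; first exact: measurable_funB.
exists (C + D); apply: filterS2 fC gD => x fx gx.
by rewrite (le_trans (ler_normB _ _))// lerD.
Qed.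

Lemma ae_boundedX (f : T -> R) (n : nat) :
  ae_bounded f -> ae_bounded (fun x => f x ^+ n).
Proof.
move=> [mf [C fC]]; split; first exact: measurable_funX.
exists (C ^+ n); apply: filterS fC => x fx.
by rewrite normrX lerXn2r ?nnegrE// (le_trans _ fx).
Qed.

Lemma ae_bounded_sum (k : nat) (f : 'I_k -> T -> R) :
  (forall i, ae_bounded (f i)) -> ae_bounded (fun x => \sum_i f i x).
Proof.
move=> bf; have -> : (fun x => \sum_i f i x) = \sum_i f i.
  by apply/funext => x; rewrite fct_sumE.
elim/big_ind: _ => [|g h|i _].
- exact: ae_bounded_cst.
- exact: ae_boundedD.
- exact: bf.
Qed.

Lemma ae_bounded_prod (k : nat) (f : 'I_k -> T -> R) :
  (forall i, ae_bounded (f i)) -> ae_bounded (fun x => \prod_i f i x).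
Proof.
elim: k f => [|k IH] f bf.
  by under eq_fun do rewrite big_ord0; exact: ae_bounded_cst.
under eq_fun do rewrite big_ord_recl.
by apply: ae_boundedM; [exact: bf|apply: IH => i; exact: bf].
Qed.

Lemma ae_bounded_Lfun (p : \bar R) (f : T -> R) :
  (1 <= p)%E -> ae_bounded f -> f \in Lfun mu p.
Proof.
move=> p1 [mf [C fC]]; apply: (@Lfun_subset _ _ _ mu p +oo%E) => //.
- by rewrite leey.
- exact: fin_num_measure.
- by rewrite leey.
rewrite inE; apply/andP; split; rewrite inE //= /finite_norm unlock /Lnorm.
case: ifPn => // _; apply: (@le_lt_trans _ _ C%:E); last exact: ltry.
by apply/ess_supP; apply: filterS fC => x /=; rewrite lee_fin.
Qed.

Lemma ae_bounded_integrable (f : T -> R) :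
  ae_bounded f -> mu.-integrable setT (EFin \o f).
Proof. by move=> bf; apply/Lfun1_integrable; exact: ae_bounded_Lfun. Qed.

Lemma ae_eq_Rintegral (f g : T -> R) :
  measurable_fun setT f -> measurable_fun setT g ->
  (\forall x \ae mu, f x = g x) -> \int[mu]_x f x = \int[mu]_x g x.
Proof.
move=> mf mg fg; rewrite /Rintegral; congr fine; apply: ae_eq_integral => //.
- exact/measurable_EFinP.
- exact/measurable_EFinP.
- by apply: filterS fg => x -> _.
Qed.

Lemma ae_le_Rintegral (f g : T -> R) : ae_bounded f -> ae_bounded g ->
  (\forall x \ae mu, f x <= g x) -> \int[mu]_x f x <= \int[mu]_x g x.
Proof.
move=> bf bg fg; have [mf [C fC]] := bf; have [mg [D gD]] := bg.
(* Monotonicity of the integral is applied to an inequality valid everywhere: [g] is replaced by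
   [maxr f g], which equals [g] a.e. and dominates [f] at every point. *)
have mm : measurable_fun setT (fun x => maxr (f x) (g x)).
  exact: measurable_maxr.
have eqm : \forall x \ae mu, maxr (f x) (g x) = g x.
  by apply: filterS fg => x; exact: max_r.
rewrite -(ae_eq_Rintegral _ _ mm mg eqm).
apply: le_Rintegral => //.
- exact: ae_bounded_integrable.
- apply: ae_bounded_integrable; split => //; exists D.
  by apply: filterS2 eqm gD => x ->.
- by move=> x _; rewrite le_max lexx.
Qed.

Lemma Rintegral_cst1 (c : R) : \int[mu]_x c = c.
Proof. by rewrite Rintegral_cst//= (@probability_setT _ _ _ mu) mulr1. Qed.

Lemma ae_bounded_RintegralD (f g : T -> R) : ae_bounded f -> ae_bounded g ->
  \int[mu]_x (f x + g x) = \int[mu]_x f x + \int[mu]_x g x.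
Proof. by move=> bf bg; apply: RintegralD => //; exact: ae_bounded_integrable. Qed.

Lemma ae_bounded_RintegralB (f g : T -> R) : ae_bounded f -> ae_bounded g ->
  \int[mu]_x (f x - g x) = \int[mu]_x f x - \int[mu]_x g x.
Proof. by move=> bf bg; apply: RintegralB => //; exact: ae_bounded_integrable. Qed.

Lemma ae_bounded_RintegralZl (c : R) (f : T -> R) : ae_bounded f ->
  \int[mu]_x (c * f x) = c * \int[mu]_x f x.
Proof. by move=> bf; apply: RintegralZl => //; exact: ae_bounded_integrable. Qed.

Lemma ae_bounded_Rintegral_sum (k : nat) (f : 'I_k -> T -> R) :
  (forall i, ae_bounded (f i)) ->
  \int[mu]_x (\sum_i f i x) = \sum_i \int[mu]_x f i x.
Proof.
elim: k f => [|k IH] f bf.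
  by under eq_Rintegral do rewrite big_ord0; rewrite big_ord0 Rintegral_cst1.
under eq_Rintegral do rewrite big_ord_recl.
rewrite ae_bounded_RintegralD// ?IH// ?big_ord_recl//.
by apply: ae_bounded_sum => i.
Qed.

Lemma Rintegral_EFin (f : T -> R) : ae_bounded f ->
  ((\int[mu]_x f x)%:E = \int[mu]_x (f x)%:E)%E.
Proof.
move=> bf; rewrite /Rintegral fineK//; apply: integrable_fin_num => //.
exact: ae_bounded_integrable.
Qed.

End ae_bounded.

(** * Classes in L^2 of essentially bounded functions *)

Section L2_class.
Context {d : measure_display} {T : measurableType d} {R : realType}.
Variable mu : probability T R.

Lemma ae_and (P Q : T -> Prop) : (\forall x \ae mu, P x) ->
  (\forall x \ae mu, Q x) -> \forall x \ae mu, P x /\ Q x.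
Proof. exact: filterI. Qed.

Local Notation L2 := (LspaceType2 mu).

(* Junk value: the class is [0] for a function that is not in L^2. *)
Definition L2_class (f : T -> R) : L2 :=
  if pselect (f \in Lfun mu 2%:E) is left f2
  then Lclass (Lfun_Sub (lee1n 2) f2) else 0.

Lemma L2_class_ae (f : T -> R) :
  ae_bounded mu f -> \forall x \ae mu, L2_class f x = f x.
Proof.
move=> bf; rewrite /L2_class; case: pselect => [f2|]; last first.
  by case; apply: ae_bounded_Lfun => //; exact: lee1n.
by apply: filterS (Lclass_ae (Lfun_Sub (lee1n 2) f2)) => x /(_ I).
Qed.

Lemma L2_class_eqP (F : L2) (f : T -> R) : ae_bounded mu f ->
  (\forall x \ae mu, F x = f x) -> F = L2_class f.
Proof.
move=> bf Ff; apply/Lspace_eqP.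
by apply: filterS2 Ff (L2_class_ae _ bf) => x -> -> _.
Qed.

Lemma L2_class_linear (a : R) (f g : T -> R) :
  ae_bounded mu f -> ae_bounded mu g ->
  L2_class (fun x => a * f x + g x) = a *: L2_class f + L2_class g.
Proof.
move=> bf bg; apply/esym/L2_class_eqP.
  by apply: ae_boundedD => //; apply: ae_boundedM => //; exact: ae_bounded_cst.
have H1 := LspaceDE (a *: L2_class f) (L2_class g).
have H2 := LspaceZE a (L2_class f).
have H3 := ae_and _ _ (L2_class_ae _ bf) (L2_class_ae _ bg).
by apply: filterS3 H1 H2 H3 => x /(_ I) -> /(_ I) -> [-> ->].
Qed.

End L2_class.

(** * Inequalities for a single PSD doubly-stochastic operator *)

Section PSD_doubly_stochastic_operator.
Context {d : measure_display} {T : measurableType d} {R : realType}.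
Variables (mu : probability T R) (M : {linear LspaceType2 mu -> LspaceType2 mu}).
Hypothesis psdM : PSD_doubly_stochastic M.
Local Notation aeb := (ae_bounded mu).
Local Notation N h := (M (L2_class mu h) : T -> R).

Lemma DS_linear (a : R) (f g : T -> R) : aeb f -> aeb g ->
  \forall x \ae mu, N (fun x => a * f x + g x) x = a * N f x + N g x.
Proof.
move=> bf bg; rewrite L2_class_linear// linearP.
have H1 := LspaceDE (a *: M (L2_class mu f)) (M (L2_class mu g)).
have H2 := LspaceZE a (M (L2_class mu f)).
by apply: filterS2 H1 H2 => x /(_ I) -> /(_ I) ->.
Qed.

Lemma DS_ge0 (f : T -> R) : aeb f -> (\forall x \ae mu, 0 <= f x) ->
  \forall x \ae mu, 0 <= N f x.
Proof.
move=> bf f0; apply: (ds_ge0 (psd_ds psdM)).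
by apply: filterS2 (L2_class_ae mu f bf) f0 => x ->.
Qed.

Lemma DS_cst (c : R) : \forall x \ae mu, N (fun=> c) x = c.
Proof.
(* This form lets [DS_linear] be used with both functions equal to 1, where [M 1 = 1] is known. *)
have -> : (fun=> c) = (fun x : T => (c - 1) * 1 + 1) by apply/funext => x; ring.
have b1 := ae_bounded_cst mu 1.
have H := Lclass_ae (Lfun_Sub (lee1n 2) (Lfun_cst mu 1 2)).
have e1 : L2_class mu (fun=> 1) = cst1_L2 mu.
  by apply/esym/L2_class_eqP => //; apply: filterS H => x /(_ I).
have H1 := DS_linear (c - 1) _ _ b1 b1.
rewrite e1 (ds_cst1 (psd_ds psdM)) in H1.
by apply: filterS2 H1 H => x /= -> /(_ I) ->; ring.
Qed.

(** Positivity is applied to [C + f] and [C - f], and [M] fixes the constant [C]. *)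
Lemma DS_le (f : T -> R) (C : R) : measurable_fun setT f ->
  (\forall x \ae mu, `|f x| <= C) -> \forall x \ae mu, `|N f x| <= C.
Proof.
move=> mf fC.
have bf : aeb f by split=> //; exists C.
have bC := ae_bounded_cst mu C.
have bCf (a : R) : aeb (fun x => a * f x + C).
  by apply: ae_boundedD => //; apply: ae_boundedM => //; exact: ae_bounded_cst.
have Hp : \forall x \ae mu, 0 <= N (fun x => 1 * f x + C) x.
  apply: DS_ge0 => //; apply: filterS fC => x.
  by rewrite ler_norml => /andP[]; lra.
have Hm : \forall x \ae mu, 0 <= N (fun x => (-1) * f x + C) x.
  apply: DS_ge0 => //; apply: filterS fC => x.
  by rewrite ler_norml => /andP[]; lra.
have Lp := ae_and mu _ _ (DS_linear 1 _ _ bf bC) Hp.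
have Lm := ae_and mu _ _ (DS_linear (-1) _ _ bf bC) Hm.
apply: filterS3 Lp Lm (DS_cst C) => x [-> Hp1] [-> Hm1] Cx.
by rewrite Cx in Hp1 Hm1; rewrite ler_norml; apply/andP; split; lra.
Qed.

Lemma DS_ae_bounded (f : T -> R) : aeb f -> aeb (N f).
Proof.
move=> [mf [C fC]]; split; first exact: measurable_mfun_mu.
by exists C; exact: DS_le.
Qed.

Lemma L2dot_EFin (F G : LspaceType2 mu) (f g : T -> R) : aeb f -> aeb g ->
  (\forall x \ae mu, F x = f x) -> (\forall x \ae mu, G x = g x) ->
  L2dot F G = (\int[mu]_x (f x * g x))%:E.
Proof.
move=> bf bg Ff Gg; rewrite Rintegral_EFin; last exact: ae_boundedM.
apply: ae_eq_integral => //.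
- apply/measurable_EFinP; apply: measurable_funM; exact: measurable_mfun_mu.
- by apply/measurable_EFinP; apply: measurable_funM; [have [] := bf|have [] := bg].
- by apply: filterS2 Ff Gg => x /= -> ->.
Qed.

Lemma PSD_selfadjoint (f g : T -> R) : aeb f -> aeb g ->
  \int[mu]_x (N f x * g x) = \int[mu]_x (f x * N g x).
Proof.
move=> bf bg; apply/EFin_inj.
have := psd_selfadjoint psdM (L2_class mu f) (L2_class mu g).
rewrite (L2dot_EFin _ _ (N f) g) ?(L2dot_EFin _ _ f (N g))//.
all: try exact: DS_ae_bounded.
all: try exact: L2_class_ae.
all: exact: nearW.
Qed.

Lemma PSD_ge0 (f : T -> R) : aeb f -> 0 <= \int[mu]_x (N f x * f x).
Proof.
move=> bf; rewrite -lee_fin.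
have := psd_ge0 psdM (L2_class mu f).
rewrite (L2dot_EFin _ _ (N f) f)//.
- exact: DS_ae_bounded.
- exact: nearW.
- exact: L2_class_ae.
Qed.

Lemma DS_integral (f : T -> R) : aeb f -> \int[mu]_x N f x = \int[mu]_x f x.
Proof.
move=> bf; have := ds_integral (psd_ds psdM) (L2_class mu f).
rewrite -Rintegral_EFin; last exact: DS_ae_bounded.
have [mf _] := bf.
have -> : (\int[mu]_x (L2_class mu f x)%:E = \int[mu]_x (f x)%:E)%E.
  apply: ae_eq_integral => //.
  - apply/measurable_EFinP; exact: measurable_mfun_mu.
  - exact/measurable_EFinP.
  - by apply: filterS (L2_class_ae mu f bf) => x -> _.
by rewrite -Rintegral_EFin// => -[].
Qed.

(** Cauchy-Schwarz against the constant 1, obtained by testing [PSD_ge0] on [f - c] with [c] the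
    mean of [f]. As [M] fixes constants and preserves the integral, the form at [f - c] equals
    [\int N f * f - c ^+ 2]. *)
Lemma sqr_integral_le_PSD (f : T -> R) : aeb f ->
  (\int[mu]_x f x) ^+ 2 <= \int[mu]_x (N f x * f x).
Proof.
move=> bf; set c := \int[mu]_x f x.
have bc := ae_bounded_cst mu (- c).
have bNf := DS_ae_bounded _ bf.
have bg : aeb (fun x => 1 * f x + - c).
  by apply: ae_boundedD => //; apply: ae_boundedM => //; exact: ae_bounded_cst.
have := PSD_ge0 _ bg.
have bcf := ae_boundedM mu _ _ (ae_bounded_cst mu c) bf.
have bcN := ae_boundedM mu _ _ (ae_bounded_cst mu c) bNf.
have bNff := ae_boundedM mu _ _ bNf bf.
have bcc := ae_bounded_cst mu (c ^+ 2).
have b_c := ae_bounded_cst mu c.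
have bh : aeb (fun x => (N f x * f x - c * f x) - (c * N f x - c ^+ 2)).
  by do !apply: ae_boundedB => //.
rewrite (ae_eq_Rintegral mu _
  (fun x => (N f x * f x - c * f x) - (c * N f x - c ^+ 2))).
- rewrite !ae_bounded_RintegralB ?ae_bounded_RintegralZl//; try exact: ae_boundedB.
  by rewrite Rintegral_cst1 DS_integral// -/c; lra.
- exact: proj1 (ae_boundedM mu _ _ (DS_ae_bounded _ bg) bg).
- by have [] := bh.
- have H1 := DS_linear 1 _ _ bf bc.
  by apply: filterS2 H1 (DS_cst (- c)) => x /= -> ->; ring.
Qed.

(* Positivity gives [0 <= N (f (u - t)^2)] for every constant [t]; the
   exceptional null set does not depend on a rational [t], and by density of
   the rationals one may take [t = u x] at almost every point [x]. *)
Lemma DS_quadratic_ge0 (f u : T -> R) : aeb f -> aeb u ->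
  (\forall x \ae mu, 0 <= f x) ->
  \forall x \ae mu, 0 <= N (fun x => f x * u x ^+ 2) x
    - u x * (2 * N (fun x => f x * u x) x) + u x ^+ 2 * N f x.
Proof.
move=> bf bu f0.
have bfu := ae_boundedM mu _ _ bf bu.
have bfu2 := ae_boundedM mu _ _ bf (ae_boundedX mu _ 2 bu).
have Ht (t : R) : \forall x \ae mu, 0 <= N (fun x => f x * u x ^+ 2) x
    - t * (2 * N (fun x => f x * u x) x) + t ^+ 2 * N f x.
  have bg : aeb (fun x => t ^+ 2 * f x + f x * u x ^+ 2).
    by apply: ae_boundedD => //; apply: ae_boundedM => //; exact: ae_bounded_cst.
  (* The function [f * (u - t) ^+ 2] is expanded into nested linear combinations, which two uses of
     [DS_linear] then split. *)
  have : \forall x \ae mu, 0 <= N (fun x => (- (2 * t)) * (f x * u x)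
      + (t ^+ 2 * f x + f x * u x ^+ 2)) x.
    apply: DS_ge0.
      by apply: ae_boundedD => //; apply: ae_boundedM => //; exact: ae_bounded_cst.
    apply: filterS f0 => x fx.
    have -> : (- (2 * t)) * (f x * u x) + (t ^+ 2 * f x + f x * u x ^+ 2)
      = f x * (u x - t) ^+ 2 by ring.
    by rewrite mulr_ge0// sqr_ge0.
  have H1 := DS_linear (- (2 * t)) _ _ bfu bg.
  have H2 := DS_linear (t ^+ 2) _ _ bf bfu2.
  by move=> H3; apply: filterS3 H1 H2 H3 => x /= -> ->; lra.
(* The rationals are enumerated through [unpickle], so that countably many null sets merge into
   one. *)
have : \forall x \ae mu, forall n : nat, forall q : rat, unpickle n = Some q ->
    0 <= N (fun x => f x * u x ^+ 2) x
    - ratr q * (2 * N (fun x => f x * u x) x) + ratr q ^+ 2 * N f x.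
  apply: ae_foralln => n; case: (unpickle n : option rat) => [q|]; last exact: nearW.
  by apply: filterS (Ht (ratr q)) => x H _ [<-].
apply: filterS => x H; apply: quadratic_ge0_rat => q.
by apply: (H (pickle q)); rewrite pickleK.
Qed.

(** Multiply [DS_quadratic_ge0] by [f] and integrate. By self-adjointness the two square terms have
    the same integral, so the factor 2 cancels. *)
Lemma PSD_weighted_le (f u : T -> R) : aeb f -> aeb u ->
  (\forall x \ae mu, 0 <= f x) ->
  \int[mu]_x (N (fun x => f x * u x) x * (f x * u x))
    <= \int[mu]_x (N f x * (f x * u x ^+ 2)).
Proof.
move=> bf bu f0.
have bfu := ae_boundedM mu _ _ bf bu.
have bfu2 := ae_boundedM mu _ _ bf (ae_boundedX mu _ 2 bu).
have b1 := ae_boundedM mu _ _ bf (DS_ae_bounded _ bfu2).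
have b2 := ae_boundedM mu _ _ (DS_ae_bounded _ bfu) bfu.
have b2' := ae_boundedM mu _ _ (ae_bounded_cst mu 2) b2.
have b3 := ae_boundedM mu _ _ (DS_ae_bounded _ bf) bfu2.
have : \int[mu]_x (2 * (N (fun x => f x * u x) x * (f x * u x))) <=
   \int[mu]_x (f x * N (fun x => f x * u x ^+ 2) x + N f x * (f x * u x ^+ 2)).
  apply: ae_le_Rintegral => //; first exact: ae_boundedD.
  apply: filterS2 (DS_quadratic_ge0 _ _ bf bu f0) f0 => x H fx.
  have := mulr_ge0 fx H; lra.
rewrite ae_bounded_RintegralZl// ae_bounded_RintegralD//.
rewrite -(PSD_selfadjoint _ _ bf bfu2); lra.
Qed.

(** Since [N f] is nonnegative only a.e., the truncation [maxr 0] keeps the denominator at least [e]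
    at every point, whence [u <= e^-1]. With [I] the integral of [f * u], the two preceding
    estimates lead to [I ^+ 2 <= I]. *)
Lemma integral_div_PSD_le1 (f : T -> R) (e : R) : aeb f ->
  (\forall x \ae mu, 0 <= f x) -> 0 < e ->
  let u x := (maxr 0 (N f x) + e)^-1 in
  aeb u /\ \int[mu]_x (f x * u x) <= 1.
Proof.
move=> bf f0 e0 u.
have v0 x : 0 < maxr 0 (N f x) + e.
  by apply: ltr_wpDl => //; rewrite le_max lexx.
have bu : aeb u.
  split.
    have mN : measurable_fun setT (N f) by exact: measurable_mfun_mu.
    have cu : continuous (fun y : R => (maxr 0 y + e)^-1).
      move=> y.
      have w0 : maxr 0 y + e != 0 by rewrite gt_eqF// ltr_wpDl// le_max lexx.
      apply: (@cvgV R R _ _ (fun y : R => maxr 0 y + e) _ w0).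
      apply: cvgD; last exact: cvg_cst.
      apply: (@continuous_max R R (fun=> 0) id); first exact: cvg_cst.
      exact: cvg_id.
    exact: measurableT_comp (continuous_measurable_fun cu) mN.
  exists e^-1; apply: nearW => x; rewrite ger0_norm ?invr_ge0 ?(ltW (v0 x))//.
  by rewrite lef_pV2 ?posrE// lerDr le_max lexx.
split => //; have bh := ae_boundedM mu _ _ bf bu.
set I := \int[mu]_x (f x * u x).
have : I ^+ 2 <= I; last first.
  by rewrite expr2; case: (lerP I 1) => // I1; rewrite ger_pMl; lra.
apply: (le_trans (sqr_integral_le_PSD _ bh)).
apply: (le_trans (PSD_weighted_le _ _ bf bu f0)).
apply: ae_le_Rintegral => //.
  apply: ae_boundedM; first exact: DS_ae_bounded.
  by apply: ae_boundedM => //; exact: ae_boundedX.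
apply: filterS2 f0 (DS_ge0 _ bf f0) => x fx Nx.
(* One factor [u] absorbs [N f], because [N f * u = N f / (N f + e) <= 1]. *)
rewrite mulrCA ler_wpM2l// expr2 mulrA ler_piMl ?invr_ge0 ?(ltW (v0 x))//.
by rewrite /u max_r// ler_pdivrMr ?mul1r ?lerDl; lra.
Qed.

End PSD_doubly_stochastic_operator.

(** * The product inequality for several operators *)

Section product_inequality.
Context {d : measure_display} {T : measurableType d} {R : realType}.
Variables (mu : probability T R) (k : nat).
Variable M : 'I_k -> {linear LspaceType2 mu -> LspaceType2 mu}.
Hypothesis psdM : forall i, PSD_doubly_stochastic (M i).
Variable f : T -> R.
Hypotheses (bf : ae_bounded mu f) (f_ge0 : \forall x \ae mu, 0 <= f x).
Local Notation c := (\int[mu]_x f x).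
Local Notation N i := (M i (L2_class mu f) : T -> R).

(** Apply [prod_add_sum_inv_ge] to [y i = (N i x + e) / c], multiply by [c ^+ k * f x] and
    integrate. Each of the [k] inverse terms contributes at most [c] inside the bracket, leaving
    [c ^+ k * (k.+1 * c - k * c)]. *)
Lemma product_integral_ge_add (e : R) : 0 < e -> 0 < c ->
  c ^+ k.+1 <= \int[mu]_x (f x * \prod_(i < k) (N i x + e)).
Proof.
move=> e0 c0; pose u i x := (maxr 0 (N i x) + e)^-1.
have bu i := proj1 (integral_div_PSD_le1 _ _ (psdM i) _ _ bf f_ge0 e0).
have fu1 i := proj2 (integral_div_PSD_le1 _ _ (psdM i) _ _ bf f_ge0 e0).
have bfu i : ae_bounded mu (fun x => f x * u i x).
  by apply: ae_boundedM => //; exact: bu.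
have bs : ae_bounded mu (fun x => \sum_i f x * u i x) by exact: ae_bounded_sum.
have bk : ae_bounded mu (fun x => k.+1%:R * f x).
  by apply: ae_boundedM => //; exact: ae_bounded_cst.
have bcs : ae_bounded mu (fun x => c * \sum_i f x * u i x).
  by apply: ae_boundedM => //; exact: ae_bounded_cst.
have bp : ae_bounded mu (fun x => f x * \prod_(i < k) (N i x + e)).
  apply: ae_boundedM => //; apply: ae_bounded_prod => i.
  by apply: ae_boundedD; [exact: DS_ae_bounded|exact: ae_bounded_cst].
have bl := ae_boundedB mu _ _ bk bcs.
apply: (@le_trans _ _ (\int[mu]_x
    (c ^+ k * (k.+1%:R * f x - c * \sum_i f x * u i x)))).
  rewrite ae_bounded_RintegralZl// ae_bounded_RintegralB//.
  rewrite !ae_bounded_RintegralZl// ae_bounded_Rintegral_sum//.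
  have : \sum_i \int[mu]_x (f x * u i x) <= \sum_(i < k) 1.
    by apply: ler_sum => i _; exact: fu1.
  rewrite sumr_const card_ord => S1.
  rewrite exprSr ler_wpM2l ?exprn_ge0 ?(ltW c0)// -natr1.
  have := ler_wpM2l (ltW c0) S1; lra.
apply: ae_le_Rintegral => //.
  by apply: ae_boundedM => //; exact: ae_bounded_cst.
have N0 : \forall x \ae mu, forall i, 0 <= N i x.
  by apply: filter_forall => i; exact: DS_ge0.
apply: filterS2 f_ge0 N0 => x fx Nx.
have w0 i : 0 < N i x + e by rewrite ltr_wpDl.
have /= := @prod_add_sum_inv_ge R k (fun i => (N i x + e) / c)
  (fun i => divr_gt0 (w0 i) c0).
have fS : f x * \sum_i ((N i x + e) / c)^-1 = c * \sum_i f x * u i x.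
  rewrite !mulr_sumr; apply: eq_bigr => i _.
  by rewrite /u max_r// invf_div; ring.
rewrite prodf_div prodr_const card_ord.
set P := \prod_(i < k) (N i x + e) => /(ler_wpM2l fx) H.
have ck : 0 < c ^+ k by rewrite exprn_gt0.
have -> : f x * P = c ^+ k * (f x * (P / c ^+ k)) by field; rewrite gt_eqF.
rewrite ler_wpM2l ?(ltW ck)// -fS; lra.
Qed.

Lemma product_integral_ge :
  c ^+ k.+1 <= \int[mu]_x (f x * \prod_(i < k) N i x).
Proof.
have [mf [B fB]] := bf.
have bp : ae_bounded mu (fun x => f x * \prod_(i < k) N i x).
  by apply: ae_boundedM => //; apply: ae_bounded_prod => i; exact: DS_ae_bounded.
have N0 : \forall x \ae mu, forall i, 0 <= N i x <= B.
  apply: filter_forall => i.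
  apply: filterS2 (DS_ge0 _ _ (psdM i) _ bf f_ge0)
    (DS_le _ _ (psdM i) _ _ mf fB) => x Nx.
  by rewrite ger0_norm// Nx.
have : 0 <= c.
  rewrite -(Rintegral_cst1 mu 0); apply: ae_le_Rintegral => //.
  exact: ae_bounded_cst.
(* The normalization by [c] requires [c > 0]. If [c = 0], the left-hand side vanishes because its
   exponent is positive, and the integrand on the right is nonnegative a.e. *)
rewrite le_eqVlt => /predU1P[c0|c0].
  have -> : c ^+ k.+1 = \int[mu]_x 0 by rewrite Rintegral_cst1 -c0 expr0n.
  apply: ae_le_Rintegral => //.
    exact: ae_bounded_cst.
  apply: filterS2 f_ge0 N0 => x fx Nx.
  by rewrite mulr_ge0// prodr_ge0// => i _; have /andP[] := Nx i.
apply/ler_addgt0Pr => r r0.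
pose K := k%:R * (`|B| + 1) ^+ k.
have K0 : 0 <= K by rewrite mulr_ge0// exprn_ge0// addr_ge0.
have Kc : 0 < K * c + 1 by have := mulr_ge0 K0 (ltW c0); lra.
(* The shift costs at most [e * K * c] in the integral, which this choice keeps below [r]. The
   minimum with 1 meets the hypothesis of [prod_addr_le], and [+ 1] makes the denominator
   positive. *)
pose e := minr 1 (r / (K * c + 1)).
have e0 : 0 < e by rewrite lt_min ltr01 divr_gt0.
have e1 : e <= 1 by rewrite ge_min lexx.
have er : e * (K * c + 1) <= r by rewrite -ler_pdivlMr// ge_min lexx orbT.
apply: (le_trans (product_integral_ge_add _ e0 c0)).
apply: (@le_trans _ _ (\int[mu]_x (f x * \prod_(i < k) N i x + e * K * f x))).
  apply: ae_le_Rintegral.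
  - apply: ae_boundedM => //; apply: ae_bounded_prod => i.
    by apply: ae_boundedD; [exact: DS_ae_bounded|exact: ae_bounded_cst].
  - by apply: ae_boundedD => //; apply: ae_boundedM => //; exact: ae_bounded_cst.
  apply: filterS2 f_ge0 N0 => x fx Nx.
  have H := @prod_addr_le R k (fun i => N i x) `|B| e.
  have {}H : \prod_(i < k) (N i x + e) <= \prod_(i < k) N i x + e * K.
    apply: H => [i|]; last by rewrite (ltW e0).
    by have /andP[-> NB] := Nx i; rewrite (le_trans NB)// ler_norm.
  have := ler_wpM2l fx H; lra.
rewrite ae_bounded_RintegralD//; last first.
  by apply: ae_boundedM => //; exact: ae_bounded_cst.
by rewrite ae_bounded_RintegralZl//; lra.
Qed.

End product_inequality.

(** * Passage to extended-real integrals and to [bounded_L2] *)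

Theorem theorem4p4 (d : measure_display) (T : measurableType d) (R : realType)
    (mu : probability T R) (k : nat) (k_ge1 : (1 <= k)%N)
    (M : 'I_k -> {linear LspaceType2 mu -> LspaceType2 mu})
    (psdM : forall i : 'I_k, PSD_doubly_stochastic (M i))
    (f : T -> R) (mf : measurable_fun [set: T] f) (bf : bounded_fun f)
    (f_ge0 : \forall x \ae mu, 0 <= f x) :
  ((\int[mu]_x (f x)%:E) ^+ k.+1
   <= \int[mu]_x (f x * \prod_(i < k) M i (bounded_L2 mu mf bf) x)%:E)%E.
Proof.
have bf' : ae_bounded mu f.
  (* [bounded_fun] provides a bound by every real strictly above [B], hence the choice [B + 1]. *)
  split=> //; have [B [_ fB]] := bf; exists (B + 1); apply: nearW => x.
  by apply: fB => //; rewrite ltrDl.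
have -> : bounded_L2 mu mf bf = L2_class mu f.
  apply: L2_class_eqP => //.
  have H := bounded_L2_ae mu mf bf.
  by apply: filterS H => x /(_ I).
rewrite -!Rintegral_EFin//.
  by rewrite -EFin_expe lee_fin; exact: product_integral_ge.
by apply: ae_boundedM => //; apply: ae_bounded_prod => i; exact: DS_ae_bounded.
Qed.
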